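(* Let $X\neq\{0\}$ be a (real or complex) Banach space, $\delta\in(0,2)$, and $\mu,\theta\in[0,1]$ satisfying $\mu\theta>1-\delta$. Then $$\Phi_X(\mu,\theta,\delta)\leq \min\left\{\Psi(\mu,\theta,\delta),\,1+\mu,\,1+\theta\right\}.$$
   Context: For a Banach space $X$ with dual $X^*$, let $\Pi(X):=\{(x,x^* )\in X\times X^* : \|x\|=\|x^*\|=x^*(x)=1\}$. For $(x,x^* )\in X\times X^*$ put $$d_\infty\big((x,x^* ),\Pi(X)\big):=\inf\big\{\max\{\|x-y\|,\|x^*-y^*\|\} : (y,y^* )\in\Pi(X)\big\}.$$ For $\delta\in(0,2)$ and $\mu,\theta\in[0,1]$ with $\mu\theta\geq 1-\delta$ define $$\Phi_X(\mu,\theta,\delta):=\sup\left\{d_\infty\big((x,x^* ),\Pi(X)\big) : x\in X,\ x^*\in X^*,\ \|x\|=\mu,\ \|x^*\|=\theta,\ \operatorname{Re} x^*(x)\geq 1-\delta\right\}.$$ For $\delta\in(0,2)$ and $\mu,\theta\in[0,1]$ with $\mu\theta>1-\delta$ define $$\Psi(\mu,\theta,\delta):=\frac{2-\mu-\theta+\sqrt{(\mu-\theta)^2+8(\mu\theta-1+\delta)}}{2}.$$ *)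

(* Defs.v *)
From HB Require Import structures.
From mathcomp Require Import all_boot all_order all_algebra.
From mathcomp Require Import all_classical all_reals all_analysis.

Set Implicit Arguments.
Unset Strict Implicit.
Unset Printing Implicit Defensive.

Import Order.TTheory GRing.Theory Num.Theory.
Import numFieldNormedType.Exports.

Local Open Scope classical_set_scope.
Local Open Scope ring_scope.

(* The definitions are shared by the two cases of real and complex scalars.
   K is the scalar field and re : K -> R the real part: K = R, re = idfun, or
   K = R[i], re = complex.Re. A norm over K takes its values in K (for K = R[i]
   these are complex numbers with zero imaginary part), so re also serves to
   read norms as elements of R. *)

Definition rnorm (R : realType) (K : numFieldType) (re : K -> R)
    (X : normedModType K) (x : X) : R :=
  re `|x|.

(* For f linear and continuous the set is nonempty and bounded, so that sup does
   not take its default value. *)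
Definition dual_norm (R : realType) (K : numFieldType) (re : K -> R)
    (X : normedModType K) (f : X -> K^o) : R :=
  sup [set re `|f x| | x in [set x : X | `|x| <= 1]].

(* Elements of X * X^*: the functionals are bundled linear maps, and their
   continuity is imposed by [dual]. *)
Definition dual (K : numFieldType) (X : normedModType K) :
    set {linear X -> K^o} :=
  [set f | continuous f].

Definition Pi_set (R : realType) (K : numFieldType) (re : K -> R)
    (X : normedModType K) : set (X * {linear X -> K^o}) :=
  [set p | [/\ dual p.2, rnorm re p.1 = 1, dual_norm re p.2 = 1
             & p.2 p.1 = 1]].

Definition dist_infty (R : realType) (K : numFieldType) (re : K -> R)
    (X : normedModType K) (p : X * {linear X -> K^o}) : \bar R :=
  ereal_inf [set (Num.max (rnorm re (p.1 - q.1))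
                          (dual_norm re (p.2 \- q.2)))%:E
            | q in Pi_set re (X := X)].

Definition Phi (R : realType) (K : numFieldType) (re : K -> R)
    (X : normedModType K) (mu theta delta : R) : \bar R :=
  ereal_sup [set dist_infty re p
            | p in [set p : X * {linear X -> K^o} |
                    [/\ dual p.2, rnorm re p.1 = mu, dual_norm re p.2 = theta
                      & 1 - delta <= re (p.2 p.1)]]].

Definition Psi (R : realType) (mu theta delta : R) : R :=
  (2 - mu - theta
   + Num.sqrt ((mu - theta) ^+ 2 + 8 * (mu * theta - 1 + delta))) / 2.

(* Main.v *)
Require Import Defs.
From HB Require Import structures.
From mathcomp Require Import all_boot all_order all_algebra.
From mathcomp Require Import all_classical all_reals all_analysis.
From mathcomp Require Import complex ring lra.

Set Implicit Arguments.
Unset Strict Implicit.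
Unset Printing Implicit Defensive.

Import Order.TTheory GRing.Theory Num.Theory.
Import numFieldNormedType.Exports.

Local Open Scope classical_set_scope.
Local Open Scope ring_scope.

(** The heart of the matter is a Bishop-Phelps-Bollobas statement with
    explicit constants. Let [g] be a functional of norm 1, [x0] a point of the
    unit ball with [1 - eta <= g x0], and [0 < k < 1]. Then there are a unit
    vector [y] and a norm-one functional [f] with [f y = 1],
    [N (x0 - y) <= eta / k] and [g - f <= 2 k N] ([support_near]). Its proof has
    two halves. Completeness of the space yields a point [y] of the ball that is
    maximal for the order [k N (u - v) <= g u - g v]
    ([ex_ball_maximal]); maximality says that the slope of [g] from [y] towards
    any other point of the ball is at most [k]. The Mazur-Orlicz form of the
    Hahn-Banach theorem ([mazur_orlicz]) then gives a functional [h <= k N]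
    which dominates [g] in all the directions that lead from [y] into the ball,
    so [g - h] attains its norm at [y], and that norm is within [k] of 1;
    normalising [g - h] costs another [k].

    For a pair [(x, G)] with norms [mu] and [theta], apply this to [x / mu] and
    [Re G / theta], for which [eta = 1 - (1 - delta) / (mu theta)]. Scaling
    back, the two components of the distance are at most
    [mu eta / k + 1 - mu] and [2 k theta + 1 - theta]. The number
    [t = Psi mu theta delta] is the larger root of
      [(t - 1 + mu) (t - 1 + theta) = 2 (mu theta - 1 + delta)],
    so that both bounds equal [t] for [k = (t - 1 + theta) / (2 theta)]. The
    condition [k < 1] is [t < 1 + theta]; when [Psi] is at least [1 + mu] or
    [1 + theta], these simpler bounds suffice. The bound [1 + theta] comes from
    the pair of [x / mu] and a functional supporting the ball there, the bound
    [1 + mu] from a norm-attaining functional at distance at most 1 of [G].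

    Real and complex scalars are treated together: everything is proved for
    real linear functionals on the underlying real space, and only the lift of
    such a functional to a scalar linear one with the same real part
    distinguishes the two cases ([real_part_axioms]). *)

(** * Sublinear functionals *)

Definition sublinear (R : realType) (V : lmodType R) (q : V -> R) : Prop :=
  (forall u v, q (u + v) <= q u + q v) /\
  (forall s v, 0 < s -> q (s *: v) <= s * q v).

Section Sublinear.
Context {R : realType} {V : lmodType R}.
Implicit Types (p q : V -> R) (C : V -> R -> Prop).

Lemma sublinearZ q s v : sublinear q -> 0 < s -> q (s *: v) = s * q v.
Proof.
move=> [_ qZ] s0; apply/eqP; rewrite eq_le qZ//=.
by rewrite -ler_pdivlMl// -{1}[v](scalerK (lt0r_neq0 s0)) qZ// invr_gt0.
Qed.

Lemma sublinear0 q : sublinear q -> q 0 = 0.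
Proof.
move=> qs; have := sublinearZ 0 qs (@ltr0n R 2); rewrite scaler0; lra.
Qed.

Lemma sublinear_geN q v : sublinear q -> - q (- v) <= q v.
Proof.
by move=> qs; have := qs.1 v (- v); rewrite subrr (sublinear0 qs); lra.
Qed.

(** [C] stands for a convex cone in [V * R]: a pair [C c r] is the demand that
    a functional take a value of at least [r] at [c]. *)
Definition convex_cone C : Prop :=
  [/\ C 0 0,
      forall c r c' r', C c r -> C c' r' -> C (c + c') (r + r')
    & forall s c r, 0 < s -> C c r -> C (s *: c) (s * r)].

(** The largest sublinear functional below [q] whose linear minorants [h] all
    satisfy [r <= h c] whenever [C c r]. *)
Definition cone_inf q C (v : V) : R :=
  inf [set z | exists c r, C c r /\ z = q (v + c) - r].

Section ConeInf.
Variables (q : V -> R) (C : V -> R -> Prop).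
Hypotheses (q_sub : sublinear q) (C_cone : convex_cone C).
Hypothesis C_le : forall c r, C c r -> r <= q c.

Lemma cone_inf_le v c r : C c r -> cone_inf q C v <= q (v + c) - r.
Proof.
move=> Ccr; apply: ge_inf; last by exists c, r.
exists (- q (- v)) => _ [c' [r' [/C_le r'c' ->]]].
by have := q_sub.1 (- v) (v + c'); rewrite addKr; lra.
Qed.

Lemma le_cone_inf v z :
  (forall c r, C c r -> z <= q (v + c) - r) -> z <= cone_inf q C v.
Proof.
move=> zC; apply: lb_le_inf.
  by have [C0 _ _] := C_cone; exists (q (v + 0) - 0), 0, 0.
by move=> _ [c [r [Ccr ->]]]; exact: zC.
Qed.

Lemma cone_inf_le_id v : cone_inf q C v <= q v.
Proof.
by have [C0 _ _] := C_cone; have := cone_inf_le v C0; rewrite addr0 subr0.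
Qed.

Lemma cone_inf_le_opp c r : C c r -> cone_inf q C (- c) <= - r.
Proof.
move=> Ccr; have := cone_inf_le (- c) Ccr.
by rewrite addNr sublinear0// sub0r.
Qed.

Lemma cone_inf_sublinear : sublinear (cone_inf q C).
Proof.
have [_ CD CZ] := C_cone; split=> [u v|s v s0].
- rewrite -lerBlDr; apply: le_cone_inf => c r Ccr.
  rewrite lerBlDl -lerBlDr; apply: le_cone_inf => c' r' Ccr'.
  have := cone_inf_le (u + v) (CD _ _ _ _ Ccr Ccr').
  by have := q_sub.1 (u + c) (v + c'); rewrite addrACA; lra.
- rewrite -ler_pdivrMl//; apply: le_cone_inf => c r Ccr.
  rewrite ler_pdivrMl//; have := cone_inf_le (s *: v) (CZ _ _ _ s0 Ccr).
  by rewrite -scalerDr (sublinearZ _ q_sub s0) mulrBr.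
Qed.

End ConeInf.

(** A chain of sublinear functionals below [p] is bounded below at each point,
    by [- p (- v)], so its pointwise infimum is a lower bound for Zorn's
    lemma. *)
Lemma ex_minimal_sublinear p : sublinear p ->
  exists q, [/\ sublinear q, forall v, q v <= p v &
    forall q', sublinear q' -> (forall v, q' v <= q v) -> q' = q].
Proof.
move=> ps.
pose T := {q : V -> R | sublinear q /\ forall v, q v <= p v}.
pose below (s t : T) := `[< forall v, sval t v <= sval s v >].
have [||||[q [qs qp]] qmin] := @Zorn T below.
- by move=> t; apply/asboolP.
- move=> r s t /asboolP rs /asboolP st; apply/asboolP => v.
  exact: le_trans (st v) (rs v).
- move=> [s sP] [t tP] /asboolP/= st /asboolP/= ts; apply: eq_exist => /=.
  by apply/funext => v; apply/eqP; rewrite eq_le st ts.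
- move=> A Atot; have [[a Aa]|A0] := pselect (A !=set0); last first.
    have pT : sublinear p /\ forall v, p v <= p v by [].
    by exists (exist _ p pT) => s As; case: A0; exists s.
  pose E v := [set sval t v | t in A].
  have Elb v t : A t -> inf (E v) <= sval t v.
    move=> At; apply: ge_inf; last by exists t.
    exists (- p (- v)) => _ [[s [ss sp]] _ <-] /=.
    by have := sublinear_geN v ss; have := sp (- v); lra.
  have leE v z : (forall t, A t -> z <= sval t v) -> z <= inf (E v).
    move=> zA; apply: lb_le_inf; first by exists (sval a v), a.
    by move=> _ [t At <-]; exact: zA.
  have Es : sublinear (fun v => inf (E v)).
    split=> [u v|s v s0].
    + rewrite -lerBlDr; apply: (leE) => t At.
      rewrite lerBlDl -lerBlDr; apply: (leE) => t' At'.
      (* The smaller of the two functionals bounds both terms. *)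
      wlog tt' : t t' u v At At' / forall w, sval t w <= sval t' w.
        move=> W; have [/asboolP|/asboolP] := Atot _ _ At At'; last exact: W.
        by move=> /(W t' t v u At' At); rewrite [v + u]addrC; lra.
      have := Elb (u + v) t At; have := (proj2_sig t).1.1 u v.
      by have := tt' v; rewrite /=; lra.
    + rewrite -ler_pdivrMl//; apply: (leE) => t At; rewrite ler_pdivrMl//.
      exact: le_trans (Elb _ _ At) ((proj2_sig t).1.2 _ _ s0).
  have Ep v : inf (E v) <= p v.
    exact: le_trans (Elb v a Aa) ((proj2_sig a).2 v).
  exists (exist _ (fun v => inf (E v)) (conj Es Ep)) => s As.
  by apply/asboolP => v; exact: Elb.
exists q; split=> // q' q's q'q.
have q'p v : q' v <= p v := le_trans (q'q v) (qp v).
have /qmin : below (exist _ q (conj qs qp)) (exist _ q' (conj q's q'p)).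
  exact/asboolP.
by move=> /(congr1 sval).
Qed.

(** Lowering [q] along the ray of [v] by [cone_inf] gives a sublinear functional
    below [q], hence [q] itself; this is the missing half
    [q u + q v <= q (u + v)] of additivity. *)
Lemma minimal_sublinear_scalar q : sublinear q ->
  (forall q', sublinear q' -> (forall v, q' v <= q v) -> q' = q) -> scalar q.
Proof.
move=> qs qmin.
have qD u v : q (u + v) = q u + q v.
  apply/eqP; rewrite eq_le qs.1/=.
  pose C c r := exists2 s, 0 <= s & c = s *: v /\ r = s * q v.
  have CC : convex_cone C.
    split.
    - by exists 0; rewrite // scale0r mul0r.
    - move=> _ _ _ _ [s s0 [-> ->]] [t t0 [-> ->]].
      by exists (s + t); [exact: addr_ge0|rewrite scalerDl mulrDl].
    - move=> s _ _ s0 [t t0 [-> ->]].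
      by exists (s * t); [rewrite mulr_ge0// ltW|rewrite scalerA mulrA].
  have Cq c r : C c r -> r <= q c.
    move=> [s]; rewrite le_eqVlt => /orP[/eqP <-|s0] [-> ->].
      by rewrite mul0r scale0r sublinear0.
    by rewrite sublinearZ.
  rewrite -{1}(qmin _ (cone_inf_sublinear qs CC Cq) (cone_inf_le_id qs CC Cq)).
  rewrite -lerBrDr; apply: cone_inf_le => //.
  by exists 1; rewrite // scale1r mul1r.
have qN v : q (- v) = - q v.
  by have := qD v (- v); rewrite subrr sublinear0//; lra.
move=> a u v; rewrite qD; congr (_ + _).
have [a0|a0|->] := ltrgt0P a; first exact: sublinearZ.
  rewrite -[a]opprK scaleNr qN sublinearZ ?oppr_gt0//; ring.
by rewrite scale0r mul0r sublinear0.
Qed.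

(** The Mazur-Orlicz theorem. A linear functional below [cone_inf q C] works:
    since [cone_inf q C (- c) <= q 0 - r], it is at most [- r] at [- c]. *)
Lemma mazur_orlicz q C : sublinear q -> convex_cone C ->
    (forall c r, C c r -> r <= q c) ->
  exists h : {scalar V},
    (forall v, h v <= q v) /\ (forall c r, C c r -> r <= h c).
Proof.
move=> qs CC Cq.
have [h [hs hq hmin]] := ex_minimal_sublinear (cone_inf_sublinear qs CC Cq).
have hl := minimal_sublinear_scalar hs hmin.
pose hL := GRing.isLinear.Build R V R *%R h hl.
pose H : {scalar V} := HB.pack h hL.
exists H; split=> [v|c r Ccr].
  exact: le_trans (hq v) (cone_inf_le_id qs CC Cq v).
have : H (- c) <= - r := le_trans (hq _) (cone_inf_le_opp qs Cq Ccr).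
by rewrite linearN lerN2.
Qed.

End Sublinear.

(** * Real and complex scalars *)

(** The real vector space underlying [X]; an alias of [X], so that the two
    scalar multiplications coexist. *)
Definition realification (R : realType) (K : numFieldType)
  (inj : {rmorphism R -> K}) (X : lmodType K) : Type := X.

Section Realification.
Context {R : realType} {K : numFieldType} (inj : {rmorphism R -> K}).
Variable X : lmodType K.
Local Notation V := (realification inj X).

HB.instance Definition _ := GRing.Zmodule.on V.

Definition real_scale (r : R) (x : V) : V := inj r *: (x : X).

Fact real_scaleA a b v : real_scale a (real_scale b v) = real_scale (a * b) v.
Proof. by rewrite /real_scale scalerA rmorphM. Qed.

Fact real_scale1 : left_id 1 real_scale.
Proof. by move=> v; rewrite /real_scale rmorph1 scale1r. Qed.

Fact real_scaleDr : right_distributive real_scale +%R.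
Proof. by move=> r u v; rewrite /real_scale scalerDr. Qed.

Fact real_scaleDl v : {morph real_scale^~ v : a b / a + b}.
Proof. by move=> a b; rewrite /real_scale rmorphD scalerDl. Qed.

HB.instance Definition _ := GRing.Zmodule_isLmodule.Build R V
  real_scaleA real_scale1 real_scaleDr real_scaleDl.

Lemma real_scaleE (r : R) (x : V) : r *: x = inj r *: (x : X) :> X.
Proof. by []. Qed.

End Realification.

(** What the proof uses of the scalar field [K], where [inj] embeds the reals
    and [re] is the real part. The last field is the only one that involves
    vector spaces: a real linear functional is the real part of a [K]-linear
    one. *)
Record real_part_axioms (R : realType) (K : numFieldType)
    (inj : {rmorphism R -> K}) (re : K -> R) : Prop := RealPartAxioms {
  reD : {morph re : a b / a + b};
  re_injM : forall r z, re (inj r * z) = r * re z;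
  re_le_norm : forall z : K, re z <= re `|z|;
  re_eq_norm : forall z : K, re z = re `|z| -> z = `|z|;
  inj_re_norm : forall z : K, inj (re `|z|) = `|z|;
  inj_le : {mono inj : r s / r <= s};
  re_lift : forall (X : lmodType K) (h : {scalar realification inj X}),
    exists F : {linear X -> K^o}, forall x, re (F x) = h x }.

Section RealPart.
Context {R : realType} {K : numFieldType}.
Context {inj : {rmorphism R -> K}} {re : K -> R}.
Hypothesis reP : real_part_axioms inj re.

Lemma re_inj r : re (inj r) = r.
Proof.
have inj_inj := inc_inj (inj_le reP).
have re1 : re 1 = 1 :> R.
  have e1 : re 1 = re `|1 : K| by rewrite normr1.
  by apply: inj_inj; rewrite e1 (inj_re_norm reP) normr1 rmorph1.
by rewrite -[inj r]mulr1 (re_injM reP) re1 mulr1.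
Qed.

Lemma reB z w : re (z - w) = re z - re w.
Proof.
by rewrite (reD reP) -[- w]mulN1r -(rmorphN1 inj) (re_injM reP) mulN1r.
Qed.

Lemma inj_lt : {mono inj : r s / r < s}.
Proof. exact: leW_mono (inj_le reP). Qed.

Lemma inj_norm r : `|inj r| = inj `|r|.
Proof.
have [r0|r0] := leP 0 r.
  by rewrite [in RHS]ger0_norm// ger0_norm// -(rmorph0 inj) (inj_le reP).
by rewrite [in RHS]ltr0_norm// ltr0_norm ?rmorphN// -(rmorph0 inj) inj_lt.
Qed.

Lemma gt0_inj (e : K) : 0 < e -> exists2 r, 0 < r & e = inj r.
Proof.
move=> e0; exists (re `|e|); last by rewrite (inj_re_norm reP) gtr0_norm.
by rewrite -inj_lt rmorph0 (inj_re_norm reP) gtr0_norm.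
Qed.

Section Norm.
Variable X : normedModType K.
Local Notation V := (realification inj X).
Local Notation N := (@rnorm R K re X).
Implicit Types (x y : X) (f : {linear X -> K^o}).

Lemma rnormE x : `|x| = inj (N x).
Proof. by have := inj_re_norm reP `|x|; rewrite normr_id. Qed.

Lemma rnorm_ge0 x : 0 <= N x.
Proof. by rewrite -(inj_le reP) rmorph0 -rnormE. Qed.

Lemma rnorm_le1 x : (`|x| <= 1) = (N x <= 1).
Proof. by rewrite rnormE -(rmorph1 inj) (inj_le reP). Qed.

Lemma rnormD x y : N (x + y) <= N x + N y.
Proof. by rewrite -(inj_le reP) rmorphD -!rnormE ler_normD. Qed.

Lemma rnormZ r x : N (inj r *: x) = `|r| * N x.
Proof.
apply: (inc_inj (inj_le reP)).
by rewrite -rnormE normrZ inj_norm rmorphM -rnormE.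
Qed.

Lemma rnormN x : N (- x) = N x.
Proof. by rewrite /rnorm normrN. Qed.

Lemma rnormB x y : N (x - y) = N (y - x).
Proof. by rewrite -rnormN opprB. Qed.

Lemma rnorm0 : N 0 = 0.
Proof. by rewrite /rnorm normr0 -(rmorph0 inj) re_inj. Qed.

Lemma rnorm_eq0 x : (N x == 0) = (x == 0).
Proof.
by rewrite -(inj_eq (inc_inj (inj_le reP))) -rnormE rmorph0 normr_eq0.
Qed.

Lemma rnorm_sublinear k : 0 <= k -> sublinear (fun v : V => k * N v).
Proof.
move=> k0; split=> [u v|s v s0].
  by rewrite -mulrDr ler_wpM2l// rnormD.
by rewrite real_scaleE rnormZ gtr0_norm// mulrCA.
Qed.

Lemma re_scalar f r : exists g : {scalar V}, forall v, g v = r * re (f v).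
Proof.
have gl : scalar (fun v : V => r * re (f v)).
  move=> a u v; rewrite real_scaleE linearP (reD reP) (re_injM reP).
  by rewrite mulrDr mulrCA.
pose gL := GRing.isLinear.Build R V R *%R (fun v : V => r * re (f v)) gl.
pose g : {scalar V} := HB.pack (fun v : V => r * re (f v)) gL.
by exists g.
Qed.

(** Rotating [v] by a scalar of modulus 1 makes [f v] equal to its modulus: the
    norm of a functional is that of its real part. *)
Lemma norm_le_of_re f c :
  (forall v, re (f v) <= c * N v) -> forall v, re `|f v| <= c * N v.
Proof.
move=> fc v; have [fv0|fv0] := eqVneq (f v) 0.
  by apply: le_trans (fc v); rewrite fv0 normr0.
pose a := `|f v| / f v.
have a1 : `|a| = 1 by rewrite normrM normrV ?unitfE// normr_id divff ?normr_eq0.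
have fav : f (a *: v) = `|f v| by rewrite linearZ; exact: divfK.
by have := fc (a *: v); rewrite fav /rnorm normrZ a1 mul1r.
Qed.

Lemma dual_norm_le (f : X -> K^o) c : 0 <= c ->
  (forall v, re `|f v| <= c * N v) -> dual_norm re f <= c.
Proof.
move=> c0 fc; apply: ge_sup; first by exists (re `|f 0|), 0; rewrite //= normr0.
move=> _ [v /= v1 <-]; apply: le_trans (fc v) _.
by rewrite -[leRHS]mulr1 ler_wpM2l// -rnorm_le1.
Qed.

Lemma bounded_dual f c : (forall v, re `|f v| <= c * N v) -> dual f.
Proof.
move=> fc; apply: bounded_linear_continuous; apply/linear_boundedP.
near=> r => v; apply: (@le_trans _ _ (inj c * `|v|)).
  by rewrite rnormE -rmorphM -(inj_re_norm reP) (inj_le reP).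
rewrite ler_wpM2r//; near: r; apply: nbhs_pinfty_ge.
by rewrite realE -(rmorph0 inj) !(inj_le reP) le_total.
Unshelve. all: by end_near. Qed.

Lemma dual_has_sup f : dual f ->
  has_sup [set re `|f x| | x in [set x : X | `|x| <= 1]].
Proof.
move=> /linear_bounded_continuous/linear_boundedP fb; split.
  by exists (re `|f 0|), 0; rewrite //= normr0.
near +oo_K => r; have r0 : 0 < r by near: r; exact: nbhs_pinfty_gt.
have [s s0 rs] := gt0_inj r0.
exists s => _ [x /= x1 <-].
rewrite -(inj_le reP) (inj_re_norm reP) -rs.
have /le_trans -> // : `|f x| <= r * `|x| by move: x {x1}; near: r.
by rewrite ger_pMr.
Unshelve. all: by end_near. Qed.

Lemma le_dual_norm f v : dual f -> re `|f v| <= dual_norm re f * N v.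
Proof.
move=> /dual_has_sup/sup_upper_bound fs.
have [->|v0] := eqVneq v 0.
  by rewrite linear0 normr0 -(rmorph0 inj) re_inj rnorm0 mulr0.
have Nv0 : 0 < N v by rewrite lt_def rnorm_eq0 v0 rnorm_ge0.
have NvV : 0 < (N v)^-1 by rewrite invr_gt0.
have fE : re `|f (inj (N v)^-1 *: v)| = (N v)^-1 * re `|f v|.
  by rewrite linearZ/= normrZ inj_norm (re_injM reP) gtr0_norm.
rewrite -ler_pdivrMr// mulrC -fE; apply: fs; exists (inj (N v)^-1 *: v) => //=.
by rewrite rnorm_le1 rnormZ gtr0_norm// mulVf ?gt_eqF.
Qed.

Lemma dual_norm_adherent f e : dual f -> 0 < e ->
  exists2 u, N u <= 1 & dual_norm re f - e < re (f u).
Proof.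
move=> /dual_has_sup fs e0; have [_ [u /= u1 <-] ue] := sup_adherent e0 fs.
have [fu0|fu0] := eqVneq (f u) 0.
  exists u; first by rewrite -rnorm_le1.
  by move: ue; rewrite fu0 normr0.
exists ((`|f u| / f u) *: u).
  rewrite -rnorm_le1 normrZ normrM normrV ?unitfE//.
  by rewrite normr_id divff ?normr_eq0// mul1r.
suff -> : f ((`|f u| / f u) *: u) = `|f u| by [].
by rewrite linearZ; exact: divfK.
Qed.

End Norm.

Lemma rnorm_complete (X : completeNormedModType K) (u : nat -> X) :
  (forall e, 0 < e ->
     exists n, forall m, (n <= m)%N -> rnorm re (u m - u n) <= e) ->
  exists y, forall e, 0 < e ->
     exists n, forall m, (n <= m)%N -> rnorm re (u m - y) <= e.
Proof.
move=> uC; have : cvg (u @ \oo).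
  apply: cauchy_cvg; apply: cauchy_exP => _ /gt0_inj[e e0 ->].
  have e2 : 0 < e / 2 by rewrite divr_gt0.
  have [n un] := uC _ e2.
  exists (u n); exists n => // m /= nm.
  rewrite -ball_normE/= rnormE inj_lt rnormB (le_lt_trans (un m nm))//.
  by rewrite ltr_pdivrMr// ltr_pMr// ltr1n.
move=> /cvg_ex[y /cvgrPdist_le uy]; exists y => e e0.
have [|n _ nP] := uy (inj e); first by rewrite -(rmorph0 inj) inj_lt.
by exists n => m /nP/=; rewrite rnormE (inj_le reP) rnormB.
Qed.

End RealPart.

(** * Norm-attaining functionals *)

Section BishopPhelps.
Context {R : realType} {K : numFieldType}.
Context {inj : {rmorphism R -> K}} {re : K -> R}.
Hypothesis reP : real_part_axioms inj re.
Variable X : completeNormedModType K.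
Local Notation V := (realification inj X).
Local Notation N := (@rnorm R K re X).

Lemma scalar_opp_le (f : {scalar V}) v :
  (forall w, f w <= N w) -> - f v <= N v.
Proof. by move=> fN; have := fN (- v); rewrite linearN rnormN. Qed.

(** Call [u] above [x] when [u] is in the ball and [k N (u - x) <= g u - g x].
    Choose [x (n + 1)] above [x n] with [g] within [1 / (n + 1)] of its supremum
    over the points above [x n]. Among all later terms [g] varies by at most
    [1 / (n + 1)], and [k N] by no more; the limit is above every [x n], so a
    point above the limit cannot have a larger value of [g]. *)
Lemma ex_ball_maximal (g : {scalar V}) (x0 : X) k : (forall v, g v <= N v) ->
  N x0 <= 1 -> 0 < k ->
  exists y : X, [/\ N y <= 1, k * N (y - x0) <= g y - g x0 &
    forall u : X, N u <= 1 -> g u - g y <= k * N (u - y)].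
Proof.
move=> gN x01 k0.
pose above (x u : X) := N u <= 1 /\ k * N (u - x) <= g u - g x.
have above_trans x y z : above x y -> above y z -> above x z.
  move=> [_ xy] [z1 yz]; split => //.
  have : k * N (z - x) <= k * (N (z - y) + N (y - x)).
    rewrite (ler_wpM2l (ltW k0))//; have := rnormD reP (z - y) (y - x).
    by rewrite addrA subrK.
  by rewrite mulrDr; lra.
have step (nx : nat * X) : exists u, N nx.2 <= 1 -> above nx.2 u /\
    forall v, above nx.2 v -> g v <= g u + nx.1.+1%:R^-1.
  case: nx => n x /=; have [x1|_] := leP (N x) 1; last by exists x0.
  pose E := [set g u | u in [set u | above x u]].
  have Eub : has_sup E.
    split.
      by exists (g x), x; rewrite //= /above !subrr (rnorm0 reP) mulr0.
    exists 1 => _ [u [u1 _] <-]; exact: le_trans (gN u) u1.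
  have n0 : 0 < n.+1%:R^-1 :> R by rewrite invr_gt0 ltr0n.
  have [_ [u xu <-] ub] := sup_adherent n0 Eub.
  exists u => _; split=> // v xv.
  have : g v <= sup E by apply: sup_upper_bound => //; exists v.
  by move: ub; rewrite ltrBlDr => ub /le_trans; apply; exact: ltW.
have [F FP] := choice step.
pose x := fix x n := if n is n'.+1 then F (n', x n') else x0.
have x1 n : N (x n) <= 1.
  by elim: n => //= n IHn; have [[]] := FP (n, x n) IHn.
have xS n : above (x n) (x n.+1) by have [] := FP (n, x n) (x1 n).
have x_sup n v : above (x n) v -> g v <= g (x n.+1) + n.+1%:R^-1.
  by have [_] := FP (n, x n) (x1 n); exact.
have x_above n m : (n <= m)%N -> above (x n) (x m).
  elim: m => [|m IHm]; rewrite leq_eqVlt => /orP[/eqP ->|//].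
  - by rewrite /above x1 !subrr (rnorm0 reP) mulr0.
  - by rewrite /above x1 !subrr (rnorm0 reP) mulr0.
  - by rewrite ltnS => /IHm/above_trans; apply; exact: xS.
have small e : 0 < e -> exists n : nat, n.+1%:R^-1 < e :> R.
  by move=> /ltr_add_invr[n]; rewrite add0r => ne; exists n.
have [e e0|y xy] := @rnorm_complete _ _ _ _ reP X x.
  have [n ne] := small (k * e) (mulr_gt0 k0 e0).
  exists n.+1 => m nm; rewrite -(ler_pM2l k0).
  have [_ /le_trans ->//] := x_above _ _ nm.
  rewrite lerBlDl (le_trans (x_sup n _ (x_above _ _ (ltnW nm))))//.
  by rewrite lerD2l ltW.
have xy_above n : above (x n) y.
  split.
  - apply/ler_addgt0Pr => e /xy[m mP]; have := mP m (leqnn m).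
    have := rnormD reP (x m) (y - x m); rewrite addrC subrK (rnormB y).
    by have := x1 m; lra.
  - apply/ler_addgt0Pr => e e0.
    (* Replacing [x m] by [y] costs [k] times their distance in the norm term
       and once their distance in [g]. *)
    have ek : 0 < e / (k + 1) by rewrite divr_gt0 ?addr_gt0.
    have [m mP] := xy _ ek.
    have [_ nm] := x_above n (maxn n m) (leq_maxl _ _).
    have := mP (maxn n m) (leq_maxr _ _).
    rewrite ler_pdivlMr ?addr_gt0// => ye.
    have : k * N (y - x n)
        <= k * (N (y - x (maxn n m)) + N (x (maxn n m) - x n)).
      rewrite (ler_wpM2l (ltW k0))//.
      have := rnormD reP (y - x (maxn n m)) (x (maxn n m) - x n).
      by rewrite addrA subrK.
    have := gN (x (maxn n m) - y).
    by rewrite linearB/= (rnormB y (x (maxn n m))); lra.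
have [y1 y0] := xy_above 0%N.
exists y; split => // u u1; rewrite leNgt; apply/negP => yu.
have uy : above y u by split => //; exact: ltW.
have : g u <= g y.
  apply/ler_addgt0Pr => e /small[n ne].
  have := x_sup n u (above_trans _ _ _ (xy_above n) uy).
  have [_] := xy_above n.+1.
  have := mulr_ge0 (ltW k0) (rnorm_ge0 reP (y - x n.+1)).
  by move: ne; set d := _^-1; lra.
by have := mulr_ge0 (ltW k0) (rnorm_ge0 reP (u - y)); lra.
Qed.

(** Mazur-Orlicz for the ray of [y], on which the functional has to dominate
    [s *: y |-> s]. *)
Lemma support_functional (y : X) : N y = 1 ->
  exists f : {scalar V}, f y = 1 /\ forall v, f v <= N v.
Proof.
move=> y1; pose C (c : V) r := exists2 s, 0 <= s & c = s *: (y : V) /\ r = s.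
have [||f [fN fC]] := @mazur_orlicz R V _ C (rnorm_sublinear reP X ler01).
- split.
  + by exists 0; rewrite // scale0r.
  + move=> _ _ _ _ [s s0 [-> ->]] [t t0 [-> ->]].
    by exists (s + t); [exact: addr_ge0|rewrite scalerDl].
  + move=> s _ _ s0 [t t0 [-> ->]].
    by exists (s * t); [rewrite mulr_ge0// ltW|rewrite scalerA].
- move=> _ _ [s s0 [-> ->]].
  by rewrite mul1r real_scaleE (rnormZ reP) y1 mulr1 ger0_norm.
exists f; split=> [|v]; last by rewrite -[leRHS]mul1r.
apply/eqP; rewrite eq_le -{1}y1 -[leRHS]mul1r fN/=; apply: fC.
by exists 1; rewrite // scale1r.
Qed.

(** The Bishop-Phelps-Bollobas theorem. At a maximal point [y], the linear
    minorant [h] of [k N] that Mazur-Orlicz provides dominates [g] on the cone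
    that the ball spans from [y]; hence [g - h] is largest over the ball at [y],
    and [f] is [g - h] divided by its norm. *)
Lemma support_near (g : {scalar V}) (x0 : X) eta k : (forall v, g v <= N v) ->
  (forall e, 0 < e -> exists2 u : X, N u <= 1 & 1 - e < g u) ->
  N x0 <= 1 -> 1 - eta <= g x0 -> 0 < k -> k < 1 ->
  exists (y : X) (f : {scalar V}),
    [/\ N y = 1, f y = 1, forall v, f v <= N v, N (x0 - y) <= eta / k &
        forall v, g v - f v <= 2 * k * N v].
Proof.
move=> gN g1 x01 gx0 k0 k1; have k0' := ltW k0.
have [y [y1 yx0 ymax]] := ex_ball_maximal gN x01 k0.
(* The cone generated by the [u - y], [u] in the unit ball: for [s > 0] the
   inequality below says that [y + s^-1 *: c] lies in the ball. *)
pose C (c : V) r := r = g c /\ exists2 s, 0 <= s & N (s *: (y : V) + c) <= s.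
have [||h [hk hC]] := @mazur_orlicz R V _ C (rnorm_sublinear reP X k0').
- split.
  + split; first by rewrite linear0.
    by exists 0; rewrite // scale0r addr0 (rnorm0 reP).
  + move=> c _ c' _ [-> [s s0 cs]] [-> [t t0 ct]].
    split; first by rewrite linearD.
    exists (s + t); first exact: addr_ge0.
    rewrite scalerDl addrACA.
    by apply: le_trans (rnormD reP _ _) _; exact: lerD.
  + move=> s c _ s0 [-> [t t0 ct]]; split; first by rewrite linearZ.
    exists (s * t); first by rewrite mulr_ge0// ltW.
    by rewrite -scalerA -scalerDr real_scaleE (rnormZ reP) gtr0_norm// ler_pM2l.
- move=> c _ [-> [s]]; rewrite le_eqVlt => /orP[/eqP <-|s0].
    rewrite scale0r add0r => c0.
    have /eqP : N c = 0 by apply/eqP; rewrite eq_le c0 (rnorm_ge0 reP).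
    by rewrite (rnorm_eq0 reP) => /eqP ->; rewrite linear0 (rnorm0 reP) mulr0.
  move=> cs; have := ymax (y + s^-1 *: c : V).
  rewrite addrAC subrr add0r linearD linearZ/= addrAC subrr add0r.
  rewrite [X in k * X](_ : _ = s^-1 * N c); last first.
    by rewrite real_scaleE (rnormZ reP) gtr0_norm ?invr_gt0.
  rewrite mulrCA ler_pM2l ?invr_gt0//; apply.
  rewrite -(ler_pM2l s0) mulr1 -[X in X * _]gtr0_norm//.
  rewrite -(rnormZ reP) -real_scaleE.
  by rewrite scalerDr scalerA divff ?gt_eqF// scale1r.
have hk_opp v : - h v <= k * N v.
  by have := hk (- v); rewrite linearN rnormN.
pose nu := g y - h y.
have f_le u : N u <= 1 -> g u - h u <= nu.
  move=> u1; have /hC : C (u - y : V) (g u - g y).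
    split; first by rewrite linearB.
    by exists 1; rewrite // scale1r addrC subrK.
  by rewrite linearB/= /nu; lra.
have nu_ge : 1 - k <= nu.
  apply/ler_addgt0Pr => e /g1[u u1 gu]; have := f_le u u1; have := hk u; nra.
have nu_le : nu <= 1 + k by have := hk_opp y; have := gN y; rewrite /nu; nra.
have nu0 : 0 < nu by lra.
have fN v : g v - h v <= nu * N v.
  have [->|v0] := eqVneq v 0; first by rewrite !linear0 (rnorm0 reP); lra.
  have Nv0 : 0 < N v by rewrite lt_def (rnorm_eq0 reP) v0 (rnorm_ge0 reP).
  have := f_le ((N v)^-1 *: (v : V)).
  rewrite !scalarZ -mulrBr ler_pdivrMl// mulrC; apply.
  by rewrite real_scaleE (rnormZ reP) gtr0_norm ?invr_gt0// mulVf ?gt_eqF.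
(* A functional that is positive and maximal over the ball at [y] forces [y] to
   the sphere. *)
have Ny : N y = 1.
  apply/eqP; rewrite eq_le y1/= -(ler_pM2l nu0) mulr1; exact: fN.
have fl : scalar (fun v : V => nu^-1 * (g v - h v)).
  by move=> a u v; rewrite !linearD/= !scalarZ; ring.
pose fL := GRing.isLinear.Build R V R *%R (fun v : V => nu^-1 * (g v - h v)) fl.
pose f : {scalar V} := HB.pack (fun v : V => nu^-1 * (g v - h v)) fL.
have fE v : f v = nu^-1 * (g v - h v) by [].
have fN' v : f v <= N v by rewrite fE ler_pdivrMl.
exists y, f; split=> //.
- by rewrite fE mulVf ?gt_eqF.
- by rewrite ler_pdivlMr// mulrC rnormB; have := gN y; lra.
(* [g - f = (nu - 1) f + h], where [nu] is within [k] of 1. *)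
- move=> v; have fNv := scalar_opp_le v fN'.
  have -> : g v = nu * f v + h v.
    by rewrite fE mulrA divff ?gt_eqF// mul1r subrK.
  have Nv := rnorm_ge0 reP v; have hv := hk v; have fv := fN' v.
  by have [n1|n1] := leP nu 1; nra.
Qed.

End BishopPhelps.

(** * The distance to the pairs of a point and a supporting functional *)

(** [Psi] is the larger root of a quadratic equation; both factors are positive
    there because the right-hand side is. *)
Lemma Psi_factor (R : realType) (mu theta delta : R)
    (t := Psi mu theta delta) : 1 - delta < mu * theta ->
  [/\ 0 < t - 1 + mu, 0 < t - 1 + theta &
      (t - 1 + mu) * (t - 1 + theta) = 2 * (mu * theta - 1 + delta)].
Proof.
move=> mt; rewrite /t /Psi; set D := (_ ^+ 2 + _).
have D0 : 0 <= D by rewrite addr_ge0 ?sqr_ge0// mulr_ge0//; lra.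
have := sqr_sqrtr D0; have := sqrtr_ge0 D; set s := Num.sqrt D.
by rewrite /D => s0 sD; split; nra.
Qed.

Section Distance.
Context {R : realType} {K : numFieldType}.
Context {inj : {rmorphism R -> K}} {re : K -> R}.
Hypothesis reP : real_part_axioms inj re.
Variable X : completeNormedModType K.
Local Notation V := (realification inj X).
Local Notation N := (@rnorm R K re X).
Implicit Types (x y : X) (G : {linear X -> K^o}) (f : {scalar V}).

(** The reduction to real functionals: lifting [f] to [K] keeps its norm and
    its value at [y]. *)
Lemma dist_infty_le x G y f t : N y = 1 -> f y = 1 -> (forall v, f v <= N v) ->
  0 <= t -> N (x - y) <= t -> (forall v, re (G v) - f v <= t * N v) ->
  (dist_infty re (x, G) <= t%:E)%E.
Proof.
move=> y1 fy fN t0 xy Gf; have [F FE] := re_lift reP f.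
have FN v : re `|F v| <= 1 * N v.
  by apply: norm_le_of_re => w; rewrite FE mul1r fN.
have dF : dual F := bounded_dual reP FN.
have Fy : re `|F y| = 1.
  apply/eqP; rewrite eq_le; have := FN y; rewrite y1 mulr1 => ->/=.
  by rewrite -fy -FE (re_le_norm reP).
have F1 : dual_norm re F = 1.
  apply/eqP; rewrite eq_le (dual_norm_le reP)//=.
  by have := le_dual_norm reP y dF; rewrite Fy y1 mulr1.
have Fy1 : F y = 1.
  have -> : F y = `|F y| by apply: (re_eq_norm reP); rewrite FE fy Fy.
  by rewrite -(inj_re_norm reP) Fy rmorph1.
apply: (@le_trans _ _ (Num.max (N (x - y)) (dual_norm re (G \- F)))%:E).
  by apply: ereal_inf_lbound; exists (y, F).
rewrite lee_fin ge_max xy/=; apply: (dual_norm_le reP) => //.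
apply: norm_le_of_re => v /=.
by rewrite (reB reP) FE.
Qed.

Lemma re_le_dual_norm G v : dual G -> re (G v) <= dual_norm re G * N v.
Proof.
by move=> dG; exact: le_trans (re_le_norm reP _) (le_dual_norm reP v dG).
Qed.

(** Take the unit vector in the direction of [x] and any functional supporting
    the ball there; the functionals are then at distance at most the sum of
    their norms. *)
Lemma dist_infty_le_1theta x G : (exists z : X, z != 0) -> dual G -> N x <= 1 ->
  0 <= dual_norm re G -> (dist_infty re (x, G) <= (1 + dual_norm re G)%:E)%E.
Proof.
move=> [z z0] dG x1 G0.
have unit w : w != 0 -> N (inj (N w)^-1 *: w) = 1.
  rewrite -(rnorm_eq0 reP) => w0; rewrite (rnormZ reP) ger0_norm ?mulVf//.
  by rewrite invr_ge0 (rnorm_ge0 reP).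
have [y y1 xy] : exists2 y, N y = 1 & N (x - y) <= 1.
  have [->|x0] := eqVneq x 0.
    by exists (inj (N z)^-1 *: z); rewrite ?sub0r ?rnormN unit.
  exists (inj (N x)^-1 *: x); first exact: unit.
  have Nx0 : 0 < N x by rewrite lt_def (rnorm_eq0 reP) x0 (rnorm_ge0 reP).
  rewrite -{1}[x]scale1r -scalerBl -(rmorph1 inj) -rmorphB (rnormZ reP).
  rewrite ler0_norm ?subr_le0 ?invf_ge1// opprB mulrBl mulVf ?gt_eqF//.
  by rewrite mul1r; lra.
have [f [fy fN]] := support_functional reP y1.
apply: (dist_infty_le y1 fy fN); [lra|lra|move=> v].
by have := re_le_dual_norm v dG; have := scalar_opp_le v fN; lra.
Qed.

(** [support_near] for [re G / theta]; undoing the normalisation contributes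
    [1 - theta]. *)
Lemma support_near_dual G x0 eta k : dual G ->
  0 < dual_norm re G -> dual_norm re G <= 1 -> N x0 <= 1 ->
  dual_norm re G * (1 - eta) <= re (G x0) -> 0 < k -> k < 1 ->
  exists y f, [/\ N y = 1, f y = 1, forall v, f v <= N v,
    N (x0 - y) <= eta / k & forall v, re (G v) - f v <=
      (2 * k * dual_norm re G + (1 - dual_norm re G)) * N v].
Proof.
set theta := dual_norm re G => dG th0 th1 x01 Gx0 k0 k1.
have [g gE] := re_scalar reP G theta^-1.
have gN v : g v <= N v by rewrite gE ler_pdivrMl//; exact: re_le_dual_norm.
have g1 e : 0 < e -> exists2 u : X, N u <= 1 & 1 - e < g u.
  move=> e0; have [u u1 uG] := dual_norm_adherent reP dG (mulr_gt0 th0 e0).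
  by exists u; rewrite // gE ltr_pdivlMl// mulrBr mulr1.
have gx0 : 1 - eta <= g x0 by rewrite gE ler_pdivlMl.
have [y [f [y1 fy fN xy gf]]] := support_near reP gN g1 x01 gx0 k0 k1.
exists y, f; split=> // v.
have -> : re (G v) = theta * g v by rewrite gE mulrA divff ?gt_eqF// mul1r.
by have := scalar_opp_le v fN; have := gf v; nra.
Qed.

(** The vectors are at distance at most the sum of their norms, so only a
    norm-attaining functional near [G] is needed. *)
Lemma dist_infty_le_1mu x G : (exists z : X, z != 0) -> dual G ->
  0 <= dual_norm re G -> dual_norm re G <= 1 -> N x <= 1 ->
  (dist_infty re (x, G) <= (1 + N x)%:E)%E.
Proof.
move=> X0 dG; rewrite le_eqVlt => /orP[/eqP G0 _ x1|G0 G1 x1].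
  apply: le_trans (dist_infty_le_1theta X0 dG x1 _) _; rewrite -G0// lee_fin.
  by rewrite lerD2l (rnorm_ge0 reP).
(* For [k = 1 / 2] the error [2 k theta + (1 - theta)] is exactly 1. *)
have [||||y [f [y1 fy fN _ Gf]]] := @support_near_dual G 0 1 (1 / 2) dG G0 G1.
- by rewrite (rnorm0 reP).
- by rewrite subrr mulr0 linear0 -(rmorph0 inj) (re_inj reP).
- lra.
- lra.
have Nx := rnorm_ge0 reP x.
apply: (dist_infty_le y1 fy fN); first lra.
  by have := rnormD reP x (- y); rewrite rnormN y1; lra.
by move=> v; have := Gf v; have := rnorm_ge0 reP v; nra.
Qed.

(** [support_near_dual] at [x / mu]; scaling [x / mu] back to [x] contributes
    [1 - mu] to the distance between the vectors. *)
Lemma dist_infty_le_Psi x G delta (t := Psi (N x) (dual_norm re G) delta) :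
  dual G -> 0 <= N x <= 1 -> 0 <= dual_norm re G <= 1 ->
  1 - delta < N x * dual_norm re G -> 1 - delta <= re (G x) ->
  t < 1 + N x -> t < 1 + dual_norm re G ->
  (dist_infty re (x, G) <= t%:E)%E.
Proof.
move=> dG /andP[mu0 mu1] /andP[th0 th1] mt Gx tmu tth.
have [a0 b0 ab] := Psi_factor mt.
move: tmu tth a0 b0 ab; rewrite -/t; clearbody t => tmu tth a0 b0 ab.
set mu := N x in mu0 mu1 mt tmu a0 ab *.
set theta := dual_norm re G in th0 th1 mt tth b0 ab *.
(* For [mu = 0], [0 < t - 1 + mu] contradicts [t < 1 + mu]; likewise for
   [theta]. *)
have {}mu0 : 0 < mu by rewrite lt_def mu0 andbT; apply/eqP => mu_eq0; nra.
have {}th0 : 0 < theta by rewrite lt_def th0 andbT; apply/eqP => th_eq0; nra.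
have mth0 : 0 < mu * theta by exact: mulr_gt0.
pose x0 := inj mu^-1 *: x.
have xE : x = inj mu *: x0.
  by rewrite scalerA -rmorphM divff ?gt_eqF// rmorph1 scale1r.
pose eta := 1 - (1 - delta) / (mu * theta).
(* The value of [k] for which both error terms equal [t]. *)
pose k := (t - 1 + theta) / (2 * theta).
have th2 : 0 < 2 * theta by rewrite mulr_gt0.
have k0 : 0 < k by exact: divr_gt0.
have k1 : k < 1 by rewrite ltr_pdivrMr//; lra.
have x01 : N x0 <= 1.
  by rewrite (rnormZ reP) ger0_norm ?mulVf ?gt_eqF// invr_ge0 ltW.
have Gx0 : theta * (1 - eta) <= re (G x0).
  rewrite linearZ/= (re_injM reP) ler_pdivlMl// mulrA opprB addrC subrK.
  by rewrite mulrCA divff ?gt_eqF// mulr1.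
have [y [f [y1 fy fN xy Gf]]] := support_near_dual dG th0 th1 x01 Gx0 k0 k1.
have etak : mu * (eta / k) = t - 1 + mu.
  apply: (mulIf (lt0r_neq0 b0)); rewrite ab /eta /k; field.
  by rewrite !gt_eqF.
have kth : 2 * k * theta + (1 - theta) = t.
  by rewrite /k; field; rewrite gt_eqF.
apply: (dist_infty_le y1 fy fN); first lra.
  have -> : x - y = inj mu *: (x0 - y) + inj (mu - 1) *: y.
    by rewrite scalerBr -xE rmorphB rmorph1 scalerBl scale1r addrA subrK.
  have := rnormD reP (inj mu *: (x0 - y)) (inj (mu - 1) *: y).
  rewrite !(rnormZ reP) y1 mulr1 gtr0_norm// ler0_norm ?subr_le0//.
  by have := ler_wpM2l (ltW mu0) xy; rewrite etak; lra.
by move=> v; have := Gf v; rewrite kth.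
Qed.

End Distance.

(** * The bound for real and complex spaces *)

Lemma Phi_le (R : realType) (K : numFieldType) (inj : {rmorphism R -> K})
    (re : K -> R) (reP : real_part_axioms inj re) (X : completeNormedModType K)
    (delta mu theta : R) :
  0 <= mu <= 1 -> 0 <= theta <= 1 -> 1 - delta < mu * theta ->
  (exists x : X, x != 0) ->
  (Phi re X mu theta delta
     <= (Num.min (Psi mu theta delta) (Num.min (1 + mu) (1 + theta)))%:E)%E.
Proof.
move=> mu01 th01 mt X0; apply: ge_ereal_sup => _ [[x G] [/= dG xmu Gth Gx] <-].
have /andP[mu0 mu1] := mu01; have /andP[th0 th1] := th01.
have d_mu : (dist_infty re (x, G) <= (1 + mu)%:E)%E.
  by rewrite -xmu (dist_infty_le_1mu reP)// ?Gth ?xmu.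
have d_th : (dist_infty re (x, G) <= (1 + theta)%:E)%E.
  by rewrite -Gth (dist_infty_le_1theta reP)// ?Gth ?xmu.
have d_Psi : (dist_infty re (x, G) <= (Psi mu theta delta)%:E)%E.
  have [mu_le|mu_lt] := leP (1 + mu) (Psi mu theta delta).
    by apply: le_trans d_mu _; rewrite lee_fin.
  have [th_le|th_lt] := leP (1 + theta) (Psi mu theta delta).
    by apply: le_trans d_th _; rewrite lee_fin.
  by rewrite -xmu -Gth (dist_infty_le_Psi reP)// ?Gth ?xmu.
by rewrite /Num.min; case: ifP => // _; case: ifP.
Qed.

Lemma idfun_real_part (R : realType) :
  @real_part_axioms R R (idfun : {rmorphism R -> R}) idfun.
Proof.
split=> //= [z|X h]; first exact: ler_norm.
have hl : linear (h : X -> R^o) by move=> a u v; exact: (linearP h).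
pose hL := GRing.isLinear.Build R X R^o *:%R (h : X -> R^o) hl.
pose H : {linear X -> R^o} := HB.pack (h : X -> R^o) hL.
by exists H.
Qed.

(** A complex linear functional with real part [h] can only be
    [x |-> h x - i h (i x)], and this one is complex linear. *)
Lemma complexify (R : realType) (X : lmodType R[i])
    (h : {scalar realification (real_complex R : {rmorphism R -> R[i]}) X}) :
  exists F : {linear X -> R[i]^o}, forall x, complex.Re (F x) = h x.
Proof.
pose V := realification (real_complex R : {rmorphism R -> R[i]}) X.
(* A complex multiple of [x] is a real combination of [x] and [i x]. *)
have hZ a b (x : X) :
    h (Complex a b *: x) = a * h x + b * h (Complex 0 1 *: x).
  have -> : Complex a b *: x = a *: (x : V) + b *: (Complex 0 1 *: x : V).
    have -> : Complex a b = real_complex R a + real_complex R b * Complex 0 1.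
      apply/eqP; rewrite eq_complex/=.
      by rewrite !mul0r !mulr0 mulr1 subr0 !addr0 add0r !eqxx.
    by rewrite scalerDl -scalerA.
  by rewrite linearD !scalarZ.
have hD (u v : X) : h (u + v) = h u + h v by exact: (linearD h).
pose F (x : X) : R[i]^o := Complex (h x) (- h (Complex 0 1 *: x)).
have Fl : linear F.
  move=> [a b] u v; rewrite /F scalerDr scalerA !hD.
  have -> : Complex 0 1 * Complex a b = Complex (- b) a.
    by rewrite /GRing.mul/= !mul0r !mul1r sub0r add0r.
  rewrite (hZ a b) (hZ (- b) a); apply/eqP; rewrite eq_complex/=.
  by apply/andP; split; apply/eqP; ring.
pose FL := GRing.isLinear.Build R[i] X R[i]^o *:%R F Fl.
pose G : {linear X -> R[i]^o} := HB.pack F FL.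
by exists G.
Qed.

Lemma complex_real_part (R : realType) :
  @real_part_axioms R R[i] (real_complex R : {rmorphism R -> R[i]})
    (@complex.Re R).
Proof.
split=> [[a b] [c d]|r [a b]|[a b]|[a b] /=|z|r s|X h] //.
- by rewrite /= mul0r subr0.
- rewrite /= (le_trans (ler_norm a))// -sqrtr_sqr ler_wsqrtr//.
  by rewrite lerDl sqr_ge0.
- move=> abE; have : a ^+ 2 = a ^+ 2 + b ^+ 2.
    by rewrite [in LHS]abE sqr_sqrtr// addr_ge0 ?sqr_ge0.
  move=> /eqP; rewrite -subr_eq0 opprD addrA subrr sub0r oppr_eq0 sqrf_eq0.
  move=> /eqP b0.
  by rewrite normc_def/= -abE b0.
- exact: lecR.
- exact: complexify.
Qed.

Theorem theorem2p1 (R : realType) (delta mu theta : R)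
  (hdelta : 0 < delta < 2) (hmu : 0 <= mu <= 1) (htheta : 0 <= theta <= 1)
  (hmt : 1 - delta < mu * theta) :
  (forall X : completeNormedModType R, (exists x : X, x != 0) ->
     (Phi (@idfun R) X mu theta delta
      <= (Num.min (Psi mu theta delta) (Num.min (1 + mu) (1 + theta)))%:E)%E)
  /\
  (forall X : completeNormedModType R[i], (exists x : X, x != 0) ->
     (Phi (@complex.Re R) X mu theta delta
      <= (Num.min (Psi mu theta delta) (Num.min (1 + mu) (1 + theta)))%:E)%E).
Proof.
split=> X X0.
- exact: (Phi_le (idfun_real_part R)).
- exact: (Phi_le (complex_real_part R)).
Qed.
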